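(* Assume that the following two conditions hold. (A1) There exist an integer $m\ge 1$ and $r\in(0,1)$ such that for all $(u,x,y)\in[0,1]\times E^2$, $\|\delta_xQ_u^m-\delta_yQ_u^m\|_{TV}\le r$. (A2) There exist $L>0$ and $\kappa\in(0,1)$ such that for all $(u,v,x)\in[0,1]^2\times E$, $\|\delta_xQ_u-\delta_xQ_v\|_{TV}\le L|u-v|^{\kappa}$. Then there exist $C>0$ and $\rho\in(0,1)$, only depending on $m,L,\kappa$ and $r$, such that for all integers $n\ge 1$ and $j\ge1$, $$\beta_n(j)\le C\rho^{[j/m]},$$ where $[x]$ denotes the integer part of $x$.
   Context: $(E,d)$ is a metric space with Borel $\sigma$-field $\mathcal{B}(E)$. $\{Q_u:u\in[0,1]\}$ is a family of Markov kernels on $(E,\mathcal{B}(E))$; by convention $Q_u=Q_0$ for $u<0$. For each integer $n\ge1$, $(X_{n,k})_{k\in\mathbb{Z},k\le n}$ is a non-homogeneous Markov chain with $\mathbb{P}(X_{n,k}\in A\mid X_{n,k-1}=x)=Q_{k/n}(x,A)$ for $k\le n$; by convention $X_{n,k}$ is equal to a fixed constant (denoted $0$) for $k\ge n+1$. For a measure $\mu$ and a kernel $R$, $\mu R(A)=\int R(x,A)\,d\mu(x)$; $\delta_x$ is the Dirac mass at $x$; $\|\mu-\nu\|_{TV}=\sup_{A}|\mu(A)-\nu(A)|$. Let $\mathcal{F}^{(n)}_i=\sigma(X_{n,j}:j\le i)$ and $$V(\mathcal{F}^{(n)}_i,X_{n,i+j})=\sup\left\{\left|\mathbb{E}[f(X_{n,i+j})\mid\mathcal{F}^{(n)}_i]-\mathbb{E}[f(X_{n,i+j})]\right|: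 f \text{ measurable},\ \|f\|_\infty\le1\right\},$$ where the conditional expectations are computed with the transition kernels of the chain. The $\beta$-mixing coefficient is $\beta_n(j)=\frac12\sup_{i\in\mathbb{Z}}\mathbb{E}[V(\mathcal{F}^{(n)}_i,X_{n,i+j})]$. *)

(* Defs.v *)
From HB Require Import structures.
From mathcomp Require Import all_boot all_order all_algebra.
From mathcomp Require Import all_classical all_reals all_analysis.
From mathcomp Require Import measurable_realfun.

Set Implicit Arguments.
Unset Strict Implicit.
Unset Printing Implicit Defensive.

Import Order.TTheory GRing.Theory Num.Theory.
Import numFieldNormedType.Exports.

Local Open Scope classical_set_scope.
Local Open Scope ring_scope.

(* The library puts a generated sigma-algebra on pointed types only, whence
   the base point; it plays no other role. *)
#[short(type="pointedMetricType")]
HB.structure Definition PointedMetric (K : numDomainType) :=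
  { M of Metric K M & Pointed M }.

Notation borelType E := (g_sigma_algebraType (@open E)).

Definition tv_dist (R : realType) (d : measure_display) (T : measurableType d)
    (mu nu : set T -> \bar R) : \bar R :=
  ereal_sup [set `|mu A - nu A|%E | A in @measurable d T].

(* The product T_0 T_1 ... T_(j-1), i.e. the kernel
   x |-> delta_x T_0 T_1 ... T_(j-1), where mu R = \int R(x, .) dmu(x). *)
Fixpoint kernel_prod (R : realType) (d : measure_display)
    (E : measurableType d) (T : nat -> R.-pker E ~> E) (j : nat) :
    R.-spker E ~> E :=
  match j with
  | 0%N => kdirac (@measurable_id _ E setT)
  | j'.+1 => mkcomp_noparam (kernel_prod T j') (T j')
  end.

Definition kernel_pow (R : realType) (d : measure_display)
    (E : measurableType d) (Q : R.-pker E ~> E) (m : nat) : R.-spker E ~> E :=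
  kernel_prod (fun=> Q) m.

(* A supremum of uncountably many random variables need not be measurable, so
   its expectation is an upper integral; by [upper_expectationE] this is the
   usual expectation as soon as the function is measurable. *)
Definition upper_expectation (R : realType) (d : measure_display)
    (Omega : measurableType d) (P : probability Omega R)
    (g : Omega -> \bar R) : \bar R :=
  ereal_inf [set \int[P]_w h w | h in
    [set h : Omega -> \bar R | measurable_fun [set: Omega] h /\ forall w, (g w <= h w)%E]]%E.

Lemma upper_expectationE (R : realType) (d : measure_display)
    (Omega : measurableType d) (P : probability Omega R)
    (g : Omega -> \bar R) :
  (forall w, (0 <= g w)%E) -> measurable_fun [set: Omega] g ->
  (upper_expectation P g = \int[P]_w g w)%E.
Proof.
move=> g0 mg; apply/eqP; rewrite eq_le; apply/andP; split.
  by apply: ereal_inf_lbound; exists g.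
apply: le_ereal_inf_tmp => _ [h [mh gh] <-].
by apply: ge0_le_integral => // w _; exact: le_trans (gh w).
Qed.

Section triangular_array.
Context (R : realType) (E : pointedMetricType R).

(* Q is a family indexed by [0, 1]: its values outside [0, 1] are never used. *)
Variables (Q : R -> R.-pker borelType E ~> borelType E) (x0 : E) (n : nat).

(* Kernel of the step from k - 1 to k. Taking the maximum with 0 encodes
   Q_u = Q_0 for u < 0; beyond time n the chain sits at the constant x0. *)
Definition transition (k : int) : R.-pker borelType E ~> borelType E :=
  if (k <= n%:Z)%R then Q (Num.max 0 (k%:~R / n%:R))
  else kdirac (@measurable_cst _ _ (borelType E) (borelType E) setT x0).

Context (d : measure_display) (Omega : measurableType d)
  (P : probability Omega R) (X : int -> {RV P >-> borelType E}).

Definition past (i : int) : set (set Omega) :=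
  <<s \bigcup_(l in [set l : int | (l <= i)%R])
        preimage_set_system setT (X l) measurable >>.

(* For k <= n, the second clause says that transition k (X (k - 1)) A is a
   version of P(X k \in A | past (k - 1)). *)
Definition markov_chain : Prop :=
  (forall k : int, (n%:Z < k)%R -> forall w, X k w = x0) /\
  (forall k : int, (k <= n%:Z)%R ->
     forall (A : set (borelType E)) (B : set Omega),
     measurable A -> past (k - 1) B ->
     P (B `&` X k @^-1` A) = \int[P]_(w in B) transition k (X (k - 1) w) A)%E.

(* The version of E[f(X_(i+j)) | past i] computed with the transition kernels,
   i.e. (delta_(X_i) T_(i+1) ... T_(i+j)) f, with T_k = transition k. *)
Definition cond_expectation (i : int) (j : nat) (f : borelType E -> R)
    (w : Omega) : \bar R :=
  (\int[kernel_prod (fun l => transition (i + (l.+1)%:Z)) j (X i w)]_y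
     (f y)%:E)%E.

Definition mixing_V (i : int) (j : nat) (w : Omega) : \bar R :=
  ereal_sup [set `|cond_expectation i j f w
                   - 'E_P[fun w' => f (X (i + j%:Z) w')]|%E | f in
    [set f : borelType E -> R |
      measurable_fun [set: borelType E] f /\ forall y, `|f y| <= 1]].

Definition beta_mixing (j : nat) : \bar R :=
  ((2^-1)%:E *
   ereal_sup [set upper_expectation P (mixing_V i j) | i in [set: int]])%E.

End triangular_array.

(* Main.v *)
(* Let the Dobrushin coefficient of a kernel K be sup_(x, y, A) (K x A - K y A).
   It is submultiplicative under composition, and beta_n(j) is at most the
   coefficient of the product of the j transition kernels following time i.
   Cut this product into blocks of length m. By (A2) a block ending at time
   k <= n differs in total variation from Q_u^m, with u = max(0, k/n), by at
   most m L (m/n)^kappa, and not at all if k <= 0. Hence by (A1) its coefficient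
   is at most rho = (1+r)/2 as soon as n >= N(m, L, kappa, r) or k <= 0. When
   n < N, every block that ends at least N blocks before time n ends at a time k <= 0,
   so discarding the last N blocks, at the price of the constant C = rho^-N,
   handles all n. If i + j > n the chain is at x0 at time i + j and the
   coefficient vanishes. *)
Require Import Defs.
From HB Require Import structures.
From mathcomp Require Import all_boot all_order all_algebra.
From mathcomp Require Import all_classical all_reals all_analysis.
From mathcomp Require Import measurable_realfun zify ring lra.

Set Implicit Arguments.
Unset Strict Implicit.
Unset Printing Implicit Defensive.

Import Order.TTheory GRing.Theory Num.Theory.
Import numFieldNormedType.Exports.

Local Open Scope classical_set_scope.
Local Open Scope ring_scope.

(* One-sided, but equivalent for probability measures to a bound on the total
   variation distance, by taking complements. *)
Definition tv_le (R : realType) (d : measure_display) (T : measurableType d)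
    (mu nu : set T -> \bar R) (c : R) : Prop :=
  forall A, measurable A -> (mu A <= nu A + c%:E)%E.

(** * Integrals of bounded functions against measures close in total variation *)

Section tv_le_integral.
Context (R : realType) (d : measure_display) (T : measurableType d).
Local Open Scope ereal_scope.

Lemma tv_le_ge0 (mu nu : {measure set T -> \bar R}) (c : R) :
  tv_le mu nu c -> (0 <= c)%R.
Proof. by move=> /(_ set0 measurable0); rewrite !measure0 add0e lee_fin. Qed.

Lemma tv_le_expectation (mu nu : probability T R) (c b : R)
    (g : {mfun T >-> R}) :
  tv_le mu nu c -> (forall x, 0 <= g x <= b)%R ->
  \int[mu]_x (g x)%:E <= \int[nu]_x (g x)%:E + (b * c)%:E.
Proof.
move=> munu gb.
have c0 := tv_le_ge0 munu.
have b0 : (0 <= b)%R by have /andP[/le_trans] := gb point; apply.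
have g0 x : (0 <= g x)%R by have /andP[] := gb x.
have := @ge0_expectation_ccdf _ _ _ mu g g0.
have := @ge0_expectation_ccdf _ _ _ nu g g0.
rewrite !expectation_def => -> ->.
(* Layer cake: compare the tails of g, which vanish beyond b. *)
have measurable_ccdf (P : probability T R) :
    measurable_fun (`[0%R, +oo[%classic : set (measurableTypeR R))
      (@ccdf _ _ _ P g).
  by apply: measurable_funTS; exact: ccdf_measurable.
have -> : (b * c)%:E = \int[lebesgue_measure]_(r in `[0%R, +oo[)
    (c * \1_(`[0%R, b[%classic : set R) r)%:E.
  transitivity (\int[lebesgue_measure]_(r in `[0%R, +oo[)
      (c%:E * (\1_(`[0%R, b[%classic : set R) r)%:E)); last first.
    by apply: eq_integral => r _; rewrite EFinM.
  rewrite ge0_integralZl_EFin//; last exact/measurable_EFinP.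
  rewrite integral_indic// setIidl; last first.
    by move=> r /=; rewrite !in_itv/= => /andP[->].
  rewrite [X in _ * X](lebesgue_measure_itv `[0%R, b[)/= lte_fin.
  case: ltP => [_|bl0]; first by rewrite sube0 -EFinM mulrC.
  by rewrite mule0 (_ : b = 0%R) ?mul0r//; apply/le_anti/andP.
rewrite -ge0_integralD//.
- apply: ge0_le_integral => //.
  + apply: emeasurable_funD; first exact: (measurable_ccdf nu).
    exact/measurable_EFinP/measurable_funM.
  + move=> r; rewrite /= in_itv/= andbT => r0.
    rewrite indicE; case: (boolP (r \in _)) => [_|/negP rb].
      rewrite mulr1; apply: munu.
      by rewrite -[X in measurable X]setTI; exact: measurable_funP.
    rewrite mulr0 adde0 [X in X <= _](_ : _ = 0)//.
    rewrite /ccdf /distribution /pushforward /=.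
    rewrite (_ : _ @^-1` _ = set0) ?measure0// -subset0 => x /=.
    rewrite in_itv/= andbT => rg; apply: rb; rewrite inE/= in_itv/= r0/=.
    by rewrite (lt_le_trans rg)//; have /andP[] := gb x.
- by move=> r _; rewrite lee_fin mulr_ge0.
- exact/measurable_EFinP/measurable_funM.
Qed.

(* Products of kernels are typed as subprobability kernels only; mass1 recovers
   the probability structure of their values. *)
Definition mass1 (mu : {measure set T -> \bar R}) & mu setT = 1 :
  set T -> \bar R := mu.

Section mass1_probability.
Variables (mu : {measure set T -> \bar R}) (mu1 : mu setT = 1).
HB.instance Definition _ := Measure.on (mass1 mu1).
HB.instance Definition _ := Measure_isProbability.Build _ _ _ (mass1 mu1) mu1.

Lemma bounded_integrable (f : T -> R) (a b : R) :
  measurable_fun setT f -> (forall x, a <= f x <= b)%R ->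
  mu.-integrable setT (EFin \o f).
Proof.
move=> mf fab; apply: measurable_bounded_integrable => //.
  by rewrite mu1 ltry.
exists (`|a| + `|b|)%R; split; first exact: num_real.
move=> M /ltW abM x _ /=; apply: le_trans abM.
have /andP[af fb] := fab x; rewrite ler_norml.
have := ler_norm b; have := ler_norm (- a); rewrite normrN => ? ?.
have := normr_ge0 a; have := normr_ge0 b => ? ?.
by apply/andP; split; lra.
Qed.

End mass1_probability.

(** Both masses are 1, so subtracting the constant [a] shifts both integrals equally and leaves a
    nonnegative integrand; only the length [b] of the range enters. *)
Lemma tv_le_integral (mu nu : {measure set T -> \bar R}) (c a b : R)
    (f : T -> R) :
  mu setT = 1 -> nu setT = 1 -> tv_le mu nu c -> measurable_fun setT f ->
  (forall x, a <= f x <= a + b)%R ->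
  \int[mu]_x (f x)%:E <= \int[nu]_x (f x)%:E + (b * c)%:E.
Proof.
move=> mu1 nu1 munu mf fab.
have mg : measurable_fun setT (fun x => f x - a)%R by exact: measurable_funB.
pose g : {mfun T >-> R} := HB.pack (fun x => f x - a)%R
  (isMeasurableFun.Build _ _ _ _ _ mg).
have gE (m : {measure set T -> \bar R}) : m setT = 1 ->
    \int[m]_x (f x)%:E = \int[m]_x (g x)%:E + a%:E.
  move=> m1; transitivity (\int[m]_x ((g x)%:E + (cst a x)%:E)).
    by apply: eq_integral => x _; rewrite -EFinD /= subrK.
  rewrite integralD_EFin//; last 2 first.
  - apply: (@bounded_integrable m m1 _ 0 b) => // x.
    by have := fab x; rewrite /=; lra.
  - by apply: (@bounded_integrable m m1 _ a a) => // x; rewrite lexx.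
  by congr (_ + _); rewrite (integral_cst m measurableT a%:E) m1 mule1.
rewrite (gE _ mu1) (gE _ nu1) addeAC leeD2r//.
by apply: (@tv_le_expectation (mass1 mu1) (mass1 nu1)) => // x /=;
  have := fab x; lra.
Qed.

Lemma tv_le_integral_ereal (mu nu : {measure set T -> \bar R}) (c a b : R)
    (f : T -> \bar R) :
  mu setT = 1 -> nu setT = 1 -> tv_le mu nu c -> measurable_fun setT f ->
  (forall x, a%:E <= f x <= (a + b)%:E) ->
  \int[mu]_x f x <= \int[nu]_x f x + (b * c)%:E.
Proof.
move=> mu1 nu1 munu mf fab.
have fE x : f x = (fine (f x))%:E.
  have /andP[af fb] := fab x; rewrite fineK// fin_numElt.
  by rewrite (lt_le_trans _ af) ?ltNyr//= (le_lt_trans fb) ?ltry.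
rewrite (eq_integral (fun x => (fine (f x))%:E))//.
rewrite [in leRHS](eq_integral (fun x => (fine (f x))%:E))//.
apply: (@tv_le_integral mu nu c a b) => //.
  exact: measurableT_comp.
by move=> x; rewrite -!lee_fin -fE.
Qed.

End tv_le_integral.

(** * Products of kernels: composition and perturbation *)

Section kernel_prod.
Context (R : realType) (d : measure_display) (E : measurableType d).
Local Open Scope ereal_scope.
Implicit Types T : nat -> R.-pker E ~> E.

Lemma integral_mkcomp_noparam (k1 k2 : R.-spker E ~> E) (x : E)
    (f : E -> \bar R) :
  (forall y, 0 <= f y) -> measurable_fun setT f ->
  \int[mkcomp_noparam k1 k2 x]_y f y = \int[k1 x]_y \int[k2 y]_z f z.
Proof.
move=> f0 mf; exact: (integral_kcomp k1 (kernel.kernel_snd k2)).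
Qed.

Lemma kernel_prod_setT T j x : kernel_prod T j x setT = 1.
Proof.
elim: j => [|j IH] /=; first by rewrite /kdirac/= diracT.
rewrite /kcomp_noparam; under eq_integral do rewrite prob_kernel.
by rewrite integral_cst// IH mule1.
Qed.

Lemma kernel_prod_le1 T j x A : measurable A -> kernel_prod T j x A <= 1.
Proof.
by move=> mA; rewrite -(kernel_prod_setT T j x) le_measure// inE.
Qed.

Lemma kernel_prodS T j x A :
  kernel_prod T j.+1 x A = \int[kernel_prod T j x]_y T j y A.
Proof. by []. Qed.

(** Chapman-Kolmogorov. Factors are appended on the right, hence the induction on [m]: the induction
    hypothesis identifies two measures, against which [T (j + m)] is then integrated. *)
Lemma kernel_prodD T j m x A : measurable A ->
  kernel_prod T (j + m) x A =
  \int[kernel_prod T j x]_y kernel_prod (fun l => T (j + l)%N) m y A.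
Proof.
elim: m A => [|m IH] A mA.
  rewrite addn0 /=; under eq_integral do rewrite /kdirac/= /dirac.
  by rewrite integral_indic// setIT.
rewrite addnS kernel_prodS.
transitivity (\int[kernel_prod T j x]_y
    \int[kernel_prod (fun l => T (j + l)%N) m y]_z T (j + m)%N z A) => //.
transitivity (\int[mkcomp_noparam (kernel_prod T j)
    (kernel_prod (fun l => T (j + l)%N) m) x]_y T (j + m)%N y A).
  by apply: eq_measure_integral => B mB _; exact: IH.
by apply: integral_mkcomp_noparam => //; exact: measurable_kernel.
Qed.

(** Factors are exchanged one at a time. The last one costs [eps] pointwise; the others cost
    [m * eps] by induction, because [T' m y A] takes values in [0, 1]. *)
Lemma kernel_prod_perturb T T' (eps : R) m x :
  (forall l, (l < m)%N -> forall y, tv_le (T l y) (T' l y) eps) ->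
  tv_le (kernel_prod T m x) (kernel_prod T' m x) (m%:R * eps).
Proof.
elim: m => [|m IH] TT' A mA; first by rewrite mul0r adde0.
have e0 : (0 <= eps)%R by exact: tv_le_ge0 (TT' m (ltnSn m) x).
have {}IH := IH (fun l lm => TT' l (ltnW lm)).
have mT (S : R.-pker E ~> E) : measurable_fun setT (S ^~ A).
  exact: measurable_kernel.
have T01 y : 0%:E <= T' m y A <= (0 + 1)%:E.
  rewrite measure_ge0 add0r/=.
  by rewrite -(prob_kernel (s:=T' m) y) le_measure// inE.
rewrite !kernel_prodS.
apply: (@le_trans _ _ (\int[kernel_prod T m x]_y (T' m y A + eps%:E))).
  apply: ge0_le_integral => //.
  - by apply: emeasurable_funD => //; exact: mT.
  - by move=> y _; exact: TT'.
rewrite ge0_integralD//.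
rewrite integral_cst// kernel_prod_setT mule1.
have := tv_le_integral_ereal (kernel_prod_setT _ _ _) (kernel_prod_setT _ _ _)
  IH (mT (T' m)) T01.
rewrite mul1r => /leeD2r /le_trans; apply.
by rewrite -natr1 mulrDl mul1r EFinD addeA.
Qed.

End kernel_prod.

(** * Dobrushin coefficients: submultiplicativity and perturbation *)

Definition dobrushin_le (R : realType) (d : measure_display)
    (E : measurableType d) (k : E -> {measure set E -> \bar R}) (c : R) :
    Prop :=
  forall x y, tv_le (k x) (k y) c.

Section dobrushin.
Context (R : realType) (d : measure_display) (E : measurableType d).
Local Open Scope ereal_scope.
Implicit Types T : nat -> R.-pker E ~> E.

Lemma tv_le_integral_oscillation (mu nu : {measure set E -> \bar R}) (b c : R)
    (f : E -> \bar R) :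
  mu setT = 1 -> nu setT = 1 -> tv_le mu nu c -> measurable_fun setT f ->
  (forall y, 0 <= f y <= 1) -> (forall y z, f y <= f z + b%:E) ->
  \int[mu]_y f y <= \int[nu]_y f y + (b * c)%:E.
Proof.
move=> mu1 nu1 munu mf f01 fosc.
have ffin y : f y \is a fin_num.
  have /andP[f0 f1] := f01 y.
  by rewrite ge0_fin_numE// (le_lt_trans f1) ?ltry.
(* f takes its values in [inf f, inf f + b]. *)
set g := fine \o f.
have inf_g : has_inf (range g).
  split; first by exists (g point), point.
  by exists 0%R => _ [y _ <-]; apply: fine_ge0; have /andP[] := f01 y.
apply: (@tv_le_integral_ereal _ _ _ mu nu c (inf (range g))) => // y.
rewrite -(fineK (ffin y)) !lee_fin; apply/andP; split.
  by apply: ge_inf; [exact: inf_g.2|exists y].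
rewrite -lerBlDr; apply: lb_le_inf; first exact: inf_g.1.
by move=> _ [z _ <-]; rewrite lerBlDr -lee_fin EFinD /g/= !fineK.
Qed.

Lemma dobrushin_le_trans (k : E -> {measure set E -> \bar R}) (b c : R) :
  (b <= c)%R -> dobrushin_le k b -> dobrushin_le k c.
Proof.
move=> bc kb x y A mA; apply: le_trans (kb x y A mA) _.
by rewrite leeD2l// lee_fin.
Qed.

(** As a function of its starting point, the mass that the second product gives to [A] oscillates by
    at most [b]; its integrals against two measures within [c] differ by at most [b * c]. *)
Lemma dobrushin_prodD T j m (b c : R) :
  dobrushin_le (kernel_prod T j) c ->
  dobrushin_le (kernel_prod (fun l => T (j + l)%N) m) b ->
  dobrushin_le (kernel_prod T (j + m)) (b * c).
Proof.
move=> Tc Tb x y A mA; rewrite !kernel_prodD//.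
apply: tv_le_integral_oscillation (Tc x y) _ _ _ => //.
- exact: kernel_prod_setT.
- exact: kernel_prod_setT.
- exact: measurable_kernel.
- by move=> z; rewrite measure_ge0 kernel_prod_le1.
- by move=> z z'; exact: Tb.
Qed.

Lemma dobrushin_prod1 T m : dobrushin_le (kernel_prod T m) 1.
Proof.
move=> x y A mA; apply: (le_trans (kernel_prod_le1 _ _ _ mA)).
by rewrite leeDr.
Qed.

Lemma dobrushin_prod_le T j j' (c : R) : (j <= j')%N ->
  dobrushin_le (kernel_prod T j) c -> dobrushin_le (kernel_prod T j') c.
Proof.
move=> jj' Tc; rewrite -(subnKC jj') -[c]mul1r.
by apply: dobrushin_prodD => //; exact: dobrushin_prod1.
Qed.

Lemma dobrushin_blocks T m p (rho : R) :
  (forall b, (b < p)%N ->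
    dobrushin_le (kernel_prod (fun l => T (b * m + l)%N) m) rho) ->
  dobrushin_le (kernel_prod T (p * m)) (rho ^+ p).
Proof.
elim: p => [|p IH] Trho; first by rewrite expr0; exact: dobrushin_prod1.
rewrite mulSnr exprS; apply: dobrushin_prodD; last exact: Trho.
by apply: IH => b bp; apply: Trho; exact: ltnW.
Qed.

(** Triangle inequality through the products of [T'] started at [x] and at [y]. One end passes from
    [T] to [T'], the other back, so both one-sided bounds serve. *)
Lemma dobrushin_perturb T T' m (r eps : R) :
  (forall l, (l < m)%N -> forall y, tv_le (T l y) (T' l y) eps) ->
  (forall l, (l < m)%N -> forall y, tv_le (T' l y) (T l y) eps) ->
  dobrushin_le (kernel_prod T' m) r ->
  dobrushin_le (kernel_prod T m) (r + 2 * (m%:R * eps)).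
Proof.
move=> TT' T'T T'r x y A mA.
apply: (le_trans (kernel_prod_perturb x TT' mA)).
apply: (@le_trans _ _ (kernel_prod T' m y A + r%:E + (m%:R * eps)%:E)).
  by rewrite leeD2r//; exact: T'r.
apply: (@le_trans _ _ (kernel_prod T m y A + (m%:R * eps)%:E + r%:E
    + (m%:R * eps)%:E)).
  by rewrite !leeD2r//; exact: kernel_prod_perturb y T'T _ mA.
by rewrite -!addeA -!EFinD leeD2l// lee_fin; lra.
Qed.

Lemma tv_le_of_tv_dist (mu nu : {measure set E -> \bar R}) (c : R) :
  nu setT = 1 -> tv_dist mu nu <= c%:E -> tv_le mu nu c.
Proof.
move=> nu1 munu A mA.
have nuA : nu A \is a fin_num.
  rewrite ge0_fin_numE// (@le_lt_trans _ _ 1) ?ltry//.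
  by rewrite -nu1 le_measure// inE.
rewrite -leeBlDl//; apply: le_trans munu; apply: le_trans (lee_abs _) _.
by apply: ereal_sup_ubound; exists A.
Qed.

End dobrushin.

(** * From the Dobrushin coefficient to the mixing coefficient *)

Section beta_mixing.
Context (R : realType) (E : pointedMetricType R)
  (Q : R -> R.-pker borelType E ~> borelType E) (x0 : E) (n : nat)
  (d : measure_display) (Omega : measurableType d) (P : probability Omega R)
  (X : int -> {RV P >-> borelType E}).
Hypothesis mcX : markov_chain Q x0 n X.
Local Open Scope ereal_scope.

(** Index shift: factor [l] is the step from time [i + l] to time [i + l + 1]. *)
Let T (i : int) (l : nat) := transition Q x0 n (i + (l.+1)%:Z).

Lemma distribution_transition (k : int) (A : set (borelType E)) :
  measurable A ->
  distribution P (X k) A =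
  \int[distribution P (X (k - 1))]_y transition Q x0 n k y A.
Proof.
move=> mA; rewrite ge0_integral_distribution//; last exact: measurable_kernel.
have [kn|nk] := leP k n%:Z.
  (* The Markov property is applied with [B = setT], which lies in the past. *)
  rewrite /distribution/= /pushforward -[X in P X]setTI mcX.2//.
  by rewrite -(setD0 setT); apply: sigma_algebraCD; exact: sigma_algebra0.
rewrite /transition leNgt nk /= /kdirac/= integral_cst//.
rewrite [X in _ * X]probability_setT mule1.
rewrite /distribution/= /pushforward indicE; case: (boolP (x0 \in A)) => x0A.
  rewrite (_ : _ @^-1` _ = setT) ?probability_setT//.
  by apply/seteqP; split=> // w _ /=; rewrite mcX.1//; exact: set_mem.
rewrite (_ : _ @^-1` _ = set0) ?measure0// -subset0 => w /=.
by rewrite mcX.1// => /mem_set; apply/negP.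
Qed.

Lemma distribution_kernel_prod (i : int) (j : nat) (A : set (borelType E)) :
  measurable A ->
  distribution P (X (i + j%:Z)) A =
  \int[distribution P (X i)]_y kernel_prod (T i) j y A.
Proof.
elim: j A => [|j IH] A mA.
  rewrite addr0 /=; under eq_integral do rewrite /kdirac/= /dirac.
  by rewrite integral_indic// setIT.
rewrite distribution_transition//.
rewrite (_ : i + j.+1%:Z - 1 = i + j%:Z)%R; last first.
  by rewrite -addn1 PoszD addrA addrK.
(* The law of [X i] is viewed as a constant kernel, so that the integration formula for composed
   kernels applies to it; [x0] merely fills its argument. *)
pose mu : pprobability (borelType E) R := distribution P (X i).
pose k : R.-pker borelType E ~> borelType E :=
  kprobability (@measurable_cst _ _ (borelType E) _ setT mu).
transitivity (\int[mkcomp_noparam k (kernel_prod (T i) j) x0]_y T i j y A).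
  by apply: eq_measure_integral => B mB _; exact: IH.
rewrite integral_mkcomp_noparam//.
exact: measurable_kernel.
Qed.

(** The law of [X (i + j)] is the average of [kernel_prod (T i) j y] over [y] drawn from the law of
    [X i], so the bound for pairs of starting points is averaged over one of them. *)
Lemma tv_le_distribution (i : int) (j : nat) (c : R) :
  dobrushin_le (kernel_prod (T i) j) c ->
  forall x, tv_le (kernel_prod (T i) j x) (distribution P (X (i + j%:Z))) c /\
    tv_le (distribution P (X (i + j%:Z))) (kernel_prod (T i) j x) c.
Proof.
move=> Tc x; have c0 : (0 <= c)%R by exact: tv_le_ge0 (Tc x x).
have mT A : measurable A -> measurable_fun setT (kernel_prod (T i) j ^~ A).
  exact: measurable_kernel.
have cst_integral (a : \bar R) : \int[distribution P (X i)]_y a = a.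
  by rewrite integral_cst// [X in _ * X]probability_setT mule1.
split=> A mA; rewrite distribution_kernel_prod//.
  rewrite -[leLHS]cst_integral -[c%:E]cst_integral -ge0_integralD//;
    last exact: mT.
  apply: ge0_le_integral => //.
    by apply: emeasurable_funD => //; exact: mT.
  by move=> y _; exact: Tc.
rewrite -[leRHS]cst_integral.
apply: ge0_le_integral => //; first exact: mT.
by move=> y _; exact: Tc.
Qed.

(** Test functions range in [-1, 1], of length 2; the resulting factor 2 cancels the 1/2 in
    [beta_mixing]. *)
Lemma mixing_V_le (i : int) (j : nat) (c : R) w :
  dobrushin_le (kernel_prod (T i) j) c ->
  mixing_V Q x0 n X i j w <= (2 * c)%:E.
Proof.
move=> Tc; apply: ge_ereal_sup => _ [f [mf f1] <-].
have [le1 le2] := tv_le_distribution Tc (X i w).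
have f11 y : (- 1 <= f y <= - 1 + 2)%R by have := f1 y; rewrite ler_norml; lra.
have D1 : distribution P (X (i + j%:Z)) setT = 1 by exact: probability_setT.
have K1 := kernel_prod_setT (T i) j (X i w).
have -> : 'E_P[fun w' => f (X (i + j%:Z) w')] =
    \int[distribution P (X (i + j%:Z))]_y (f y)%:E.
  have fX : P.-integrable setT (EFin \o (f \o X (i + j%:Z))).
    apply: (@bounded_integrable _ _ _ P (probability_setT P) _ (- 1) 1).
      exact: measurableT_comp.
    by move=> w'; have := f11 (X (i + j%:Z) w'); rewrite /=; lra.
  by rewrite unlock integral_distribution//; exact/measurable_EFinP.
rewrite /cond_expectation -/(T i).
have := tv_le_integral K1 D1 le1 mf f11.
have := tv_le_integral D1 K1 le2 mf f11.
have ifin (m : {measure set (borelType E) -> \bar R}) : m setT = 1 ->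
    \int[m]_y (f y)%:E \is a fin_num.
  move=> m1; apply: integrable_fin_num => //.
  exact: (bounded_integrable m1 mf f11).
move: (ifin _ K1) (ifin _ D1).
case: (\int[_]_y (f y)%:E) => // a _; case: (\int[_]_y (f y)%:E) => // b _.
by rewrite -!EFinD !lee_fin /= => h1 h2; rewrite ler_norml; lra.
Qed.

Lemma beta_mixing_le (j : nat) (c : R) :
  (forall i, dobrushin_le (kernel_prod (T i) j) c) ->
  beta_mixing Q x0 n X j <= c%:E.
Proof.
move=> Tc.
rewrite (_ : c = 2^-1 * (2 * c))%R; last by field.
rewrite EFinM lee_pmul2l// ?lte_fin ?invr_gt0//.
apply: ge_ereal_sup => _ [i _ <-]; apply: ereal_inf_lbound.
(* A constant majorant of [mixing_V] is measurable, hence a candidate in the infimum defining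
   [upper_expectation]. *)
exists (cst (2 * c)%:E); last first.
  by rewrite integral_cst// [X in _ * X]probability_setT mule1.
by split=> // w; exact: mixing_V_le.
Qed.

End beta_mixing.

(** * Contraction of the transition kernels over blocks *)

Section transition.
Context (R : realType) (E : pointedMetricType R)
  (Q : R -> R.-pker borelType E ~> borelType E) (x0 : E) (n m : nat)
  (r L kappa : R).
Hypotheses (n0 : (0 < n)%N) (L0 : 0 <= L) (kappa0 : 0 < kappa).
Hypothesis contraction : forall (u : R) (x y : borelType E), 0 <= u <= 1 ->
  (tv_dist (kernel_pow (Q u) m x) (kernel_pow (Q u) m y) <= r%:E)%E.
Hypothesis holder : forall (u v : R) (x : borelType E),
  0 <= u <= 1 -> 0 <= v <= 1 ->
  (tv_dist (Q u x) (Q v x) <= (L * `|u - v| `^ kappa)%:E)%E.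

Lemma tv_le_holder (u v eps : R) (x : borelType E) :
  0 <= u <= 1 -> 0 <= v <= 1 -> L * `|u - v| `^ kappa <= eps ->
  tv_le (Q u x) (Q v x) eps.
Proof.
move=> u01 v01 uv; apply: tv_le_of_tv_dist; first exact: prob_kernel.
by apply: le_trans (holder x u01 v01) _; rewrite lee_fin.
Qed.

Lemma dobrushin_transition_block (k : int) (eps : R) :
  0 <= eps -> k + m%:Z <= n%:Z ->
  k + m%:Z <= 0 \/ L * (m%:R / n%:R) `^ kappa <= eps ->
  dobrushin_le (kernel_prod (fun l => transition Q x0 n (k + l.+1%:Z)) m)
    (r + 2 * (m%:R * eps)).
Proof.
move=> eps0 kmn small.
have n_gt0 : 0 < n%:R :> R by rewrite ltr0n.
pose u (l : int) : R := Num.max 0 (l%:~R / n%:R).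
have u01 (l : int) : l <= n%:Z -> 0 <= u l <= 1.
  move=> ln; rewrite le_max lexx/= ge_max ler01/= ler_pdivrMr// mul1r.
  by rewrite -[n%:R]/(n%:Z%:~R) ler_int.
have lm l : (l < m)%N -> k + l.+1%:Z <= k + m%:Z by move=> ?; lia.
have lmn l : (l < m)%N -> k + l.+1%:Z <= n%:Z by move=> /lm/le_trans; apply.
have dist_u l : (l < m)%N ->
    L * `|u (k + l.+1%:Z) - u (k + m%:Z)| `^ kappa <= eps.
  move=> lm'; case: small => [km0|]; last apply: le_trans.
    have u0 (a : int) : a <= 0 -> u a = 0.
      by move=> a0; apply/max_idPl; rewrite pmulr_lle0 ?invr_gt0// lerz0.
    rewrite !u0//; last by apply: le_trans km0; exact: lm.
    (* Here [kappa <> 0] matters, since 0 to the power 0 is 1. *)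
    by rewrite subrr normr0 powR0 ?mulr0// gt_eqF.
  apply: ler_wpM2l => //; apply: ge0_ler_powR; rewrite ?nnegrE//.
  - exact: ltW.
  (* Clipping at 0 is 1-Lipschitz, so the parameters differ by at most [(m - l - 1) / n]. *)
  have maxB (a b : R) : a <= b -> `|Num.max 0 a - Num.max 0 b| <= b - a.
    by move=> ab; rewrite ler_norml; case: (leP 0 a); case: (leP 0 b); lra.
  apply: le_trans (maxB _ _ _) _.
    by rewrite ler_pM2r ?invr_gt0// ler_int lm.
  rewrite -mulrBl ler_pM2r ?invr_gt0// -intrB -[m%:R]/(m%:Z%:~R) ler_int.
  lia.
have TE l : (l < m)%N -> transition Q x0 n (k + l.+1%:Z) = Q (u (k + l.+1%:Z)).
  by move=> lm'; rewrite /transition lmn.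
(* The block is compared with the power of the kernel at its last time. *)
apply: (@dobrushin_perturb _ _ _ _ (fun=> Q (u (k + m%:Z)))).
- move=> l lm' y; rewrite TE//; apply: tv_le_holder; [| |exact: dist_u];
  by apply: u01 => //; exact: lmn.
- move=> l lm' y; rewrite TE//.
  apply: tv_le_holder; [| |rewrite distrC; exact: dist_u];
  by apply: u01 => //; exact: lmn.
- move=> x y; apply: tv_le_of_tv_dist; first exact: kernel_prod_setT.
  by apply: contraction; exact: u01.
Qed.

(** The last factor, present since [0 < j], is the Dirac mass at [x0] and forgets the starting
    point. *)
Lemma dobrushin_transition_after (i : int) (j : nat) :
  (0 < j)%N -> n%:Z < i + j%:Z ->
  dobrushin_le (kernel_prod (fun l => transition Q x0 n (i + l.+1%:Z)) j) 0.
Proof.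
case: j => // j _ nij x y A mA; rewrite !kernel_prodS.
have /negbTE nij' : ~~ (i + j.+1%:Z <= n%:Z) by rewrite -ltNge.
rewrite /transition nij' /= adde0 !integral_cst//.
by rewrite !kernel_prod_setT.
Qed.

Lemma dobrushin_transition (eps : R) (N : nat) (i : int) (j : nat) :
  0 <= r -> 0 < eps -> 0 < r + 2 * (m%:R * eps) <= 1 ->
  (0 < m)%N -> (0 < j)%N ->
  ((N <= n)%N -> L * (m%:R / n%:R) `^ kappa <= eps) ->
  dobrushin_le (kernel_prod (fun l => transition Q x0 n (i + l.+1%:Z)) j)
    ((r + 2 * (m%:R * eps)) ^- N * (r + 2 * (m%:R * eps)) ^+ (j %/ m)).
Proof.
move=> r0 eps0; set rho := r + _ => /andP[rho0 rho1] m0 j0 small.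
have [nij|ijn] := ltP n%:Z (i + j%:Z).
  apply: dobrushin_le_trans (dobrushin_transition_after j0 nij).
  by rewrite mulr_ge0 ?invr_ge0 ?exprn_ge0// ltW.
(* The subtraction is truncated: with at most [N] blocks the exponent is 0, and the target bound is
   at least 1. *)
apply: (@dobrushin_le_trans _ _ _ _ (rho ^+ (j %/ m - N))).
  rewrite mulrC ler_pdivlMr ?exprn_gt0// -exprD.
  by apply: ler_wiXn2l; rewrite ?(ltW rho0)//; lia.
apply: (@dobrushin_prod_le _ _ _ _ ((j %/ m - N) * m)).
  by rewrite (leq_trans _ (leq_trunc_div j m))// leq_mul2r leq_subr orbT.
apply: dobrushin_blocks => b bq.
have bmN : (b.+1 * m + N * m <= j)%N.
  rewrite -mulnDl (leq_trans _ (leq_trunc_div j m))// leq_mul2r; lia.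
have NNm : (N <= N * m)%N by rewrite leq_pmulr.
rewrite mulSn in bmN.
have -> : (fun l => transition Q x0 n (i + (b * m + l).+1%:Z)) =
    (fun l => transition Q x0 n (i + (b * m)%N%:Z + l.+1%:Z)).
  by apply/funext => l; rewrite -addrA -PoszD addnS.
apply: dobrushin_transition_block; first exact: ltW.
  lia.
(* If [n < N], the block ends at time [i + b * m + m <= n - N * m <= n - N < 0]. *)
by have [/small|nN] := leqP N n; [right|left; lia].
Qed.

End transition.

(** * Choice of the constants and conclusion *)

Theorem proposition1 (R : realType) (m : nat) (r L kappa : R)
    (hm : (1 <= m)%N) (hr : 0 < r < 1) (hL : 0 < L) (hkappa : 0 < kappa < 1) :
  exists C rho : R, [/\ 0 < C, 0 < rho < 1 &
    forall (E : pointedMetricType R) (x0 : E)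
      (Q : R -> R.-pker borelType E ~> borelType E),
    (forall (u : R) (x y : borelType E), 0 <= u <= 1 ->
       (tv_dist (kernel_pow (Q u) m x) (kernel_pow (Q u) m y) <= r%:E)%E) ->
    (forall (u v : R) (x : borelType E), 0 <= u <= 1 -> 0 <= v <= 1 ->
       (tv_dist (Q u x) (Q v x) <= (L * `|u - v| `^ kappa)%:E)%E) ->
    forall (d : nat -> measure_display)
      (Omega : forall n, measurableType (d n))
      (P : forall n, probability (Omega n) R)
      (X : forall n, int -> {RV (P n) >-> borelType E}),
    (forall n : nat, (1 <= n)%N -> markov_chain Q x0 n (X n)) ->
    forall n j : nat, (1 <= n)%N -> (1 <= j)%N ->
      (beta_mixing Q x0 n (X n) j <= (C * rho ^+ (j %/ m))%:E)%E].
Proof.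
have /andP[r0 r1] := hr; have /andP[kappa0 _] := hkappa.
have m0 : 0 < m%:R :> R by rewrite ltr0n.
(* Chosen so that [2 * m * eps] is half the gap [1 - r], which puts [rho] midway between [r] and
   1. *)
pose eps : R := (1 - r) / (4 * m%:R).
have eps0 : 0 < eps by rewrite divr_gt0 ?subr_gt0// mulr_gt0.
pose rho : R := r + 2 * (m%:R * eps).
have rhoE : rho = (1 + r) / 2 by rewrite /rho /eps; field; rewrite gt_eqF.
have rho01 : 0 < rho < 1 by rewrite rhoE; apply/andP; split; lra.
(* [t] solves [L * t ^ kappa = eps], so the smallness condition reads [m / n <= t], which [n >= N]
   guarantees. *)
pose t : R := (eps / L) `^ kappa^-1.
have t0 : 0 < t by apply: powR_gt0; rewrite divr_gt0.
pose N := Num.bound (m%:R / t).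
exists (rho ^- N), rho; split=> //.
  by rewrite invr_gt0 exprn_gt0//; case/andP: rho01.
move=> E x0 Q hQ1 hQ2 d Omega P X mcX n j n1 j1.
apply: beta_mixing_le => [|i]; first exact: mcX.
apply: (@dobrushin_transition _ _ _ _ _ _ _ L kappa) => //.
- exact: ltW.
- exact: ltW.
- by case/andP: rho01 => ? /ltW ->; apply/andP.
move=> Nn; rewrite mulrC -ler_pdivlMr//.
have -> : eps / L = t `^ kappa.
  by rewrite /t -powRrM mulVf ?gt_eqF// powRr1// divr_ge0// ltW.
have n0 : 0 < n%:R :> R by rewrite ltr0n.
apply: ge0_ler_powR; rewrite ?nnegrE ?(ltW t0) ?(ltW kappa0)//.
rewrite ler_pdivrMr// mulrC -ler_pdivrMr//.
have /ltW : m%:R / t < N%:R by apply: archi_boundP; rewrite divr_ge0// ltW.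
by move=> /le_trans; apply; rewrite ler_nat.
Qed.
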